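(* Let $X_{\lambda,\epsilon}$ be a smooth planar slow-fast system satisfying Assumptions 1--4 (stated in the context), let $S_0:L\to T$ be a slow relation function defined as in case (a) or case (b) of the context, and let $D_{en}:\mathbb R\to\mathbb R$ be an (entry) density supported on $L$. Then $D_{en}$ is transformed by $S_0$ into the following (exit) density supported on $T$: $$D_{ex}(s^+)=-D_{en}(S_0^{-1}(s^+))\,\frac{\tilde I_+'(s^+)}{\tilde I_-'(S_0^{-1}(s^+))}\,1_T(s^+).$$ That is, if $\mu_0$ is the Borel probability measure on $\mathbb R$ with density $D_{en}$, then its push-forward $\mu_0S_0^{-1}$ has density $D_{ex}$.
   Context: Smooth means $C^\infty$. A density is a nonnegative $D\in L^1(\mathbb R)$ such that $\mu(A)=\int_AD(x)\,dx$ defines a Borel probability measure on $\mathbb R$. $1_T$ is the characteristic function of $T$ (the expression for $D_{ex}$ is understood as $0$ outside $T$). For a measure $\mu$ supported on $L$, the push-forward is $\mu S_0^{-1}(A)=\mu(S_0^{-1}(A))$. **Slow-fast system.** Let $M\subset\mathbb R^2$ be open, $\lambda_0\in\mathbb R^r$, and let $X_{\lambda,\epsilon}=X_{\lambda,0}+\epsilon Q_\lambda+O(\epsilon^2)$ be a smooth family of vector fields on $M$, with $0\le\epsilon\ll1$ and $\lambda$ in a small neighborhood of $\lambda_0$. The fast subsystem $X_{\lambda,0}$ has a set $\mathcal S_\lambda$ (critical curve) of non-isolated singularities, and each $p\in\mathcal S_{\lambda_0}$ has an open neighborhood $U\subset M$ on which $X_{\lambda,0}=F_\lambda Z_\lambda$,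 where $F_\lambda$ is a smooth family of functions with $\nabla F_\lambda\neq0$ on $\{F_\lambda=0\}$ and $Z_\lambda$ is a smooth family of vector fields without singularities; so $\mathcal S_\lambda\cap U=\{F_\lambda=0\}$. The fast foliation $\mathcal F_\lambda$ is the smooth one-dimensional foliation on $M$ tangent to $Z_\lambda$ in each such local expression; $l_{\lambda,p}$ is its leaf through $p$. Away from $\mathcal S_\lambda$, orbits of $X_{\lambda,0}$ lie in leaves of $\mathcal F_\lambda$. A point $p\in\mathcal S_\lambda$ is normally hyperbolic if $DX_{\lambda,0}(p)$ has a nonzero eigenvalue $E_\lambda(p)$ (equal to the divergence of $X_{\lambda,0}$ at $p$); it is attracting if $E_\lambda(p)<0$, repelling if $E_\lambda(p)>0$. A point $p\in\mathcal S_\lambda$ is a contact point if both eigenvalues of $DX_{\lambda,0}(p)$ are zero. A curve in $\mathcal S_\lambda$ is normally attracting (repelling) if all its points are normally hyperbolic and attracting (repelling). The contact order $n$ of a contact point $p_0$ (for $\lambda=\lambda_0$) is the intersection multiplicity at $p_0$ of $\mathcal S_{\lambda_0}$ and the leaf $l_{\lambda_0,p_0}$ (possibly $n=\infty$). Its singularity order $m$ is the order at $p_0$ of the function $p\in\mathcal S_{\lambda_0}\cap U\mapsto\Omega(Q_{\lambda_0},Z_{\lambda_0})(p)$, where $X_{\lambda,0}=F_\lambda Z_\lambda$ is a local expression on an open neighborhood $U\subset M$ of $p_0$, with $F_\lambda$ a smooth family of functions such that $\nabla F_\lambda\neq0$ on $\{F_\lambda=0\}$ and $Z_\lambda$ a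 smooth family of vector fields without singularities, and $\Omega$ is any area form on $U$ (independent of choices). At a normally hyperbolic $p\in\mathcal S_\lambda$, the slow vector field $\hat Q_\lambda(p)\in T_p\mathcal S_\lambda$ is the linear projection of $Q_\lambda(p)$ onto $T_p\mathcal S_\lambda$ in the direction parallel to $T_pl_{\lambda,p}$; its time variable (slow time) is $\tau$. For a normally hyperbolic segment $\gamma\subset\mathcal S_\lambda$ without singularities of $\hat Q_\lambda$, the slow divergence integral is $I(\gamma,\lambda)=\int_{\tau_1}^{\tau_2}E_\lambda(\tilde\gamma(\tau))\,d\tau$, where $\tilde\gamma:[\tau_1,\tau_2]\to\mathbb R^2$ parameterizes $\gamma$, $\tilde\gamma'(\tau)=\hat Q_\lambda(\tilde\gamma(\tau))$ and $\tilde\gamma(\tau_1),\tilde\gamma(\tau_2)$ are the end points of $\gamma$. **Assumptions.** - Assumption 1: $\mathcal S_{\lambda_0}=\gamma_-\cup\{p_0\}\cup\gamma_+$, where $\gamma_-$ is normally attracting, $\gamma_+$ is normally repelling and $p_0$ is a contact point between them. - Assumption 2: the singularity order $m$ of $p_0$ is finite and odd. - Assumption 3: $\hat Q_{\lambda_0}$ has no singularities on $\gamma_-\cup\gamma_+$ and points from $\gamma_-$ to $\gamma_+$. - Assumption 4: $m<2(n-1)$. Under these assumptions the following limits are finite: for a segment $[q,p_0]\subset\gamma_-\cup\{p_0\}$, $I_-([q,p_0])=\lim_{p\to p_0,\,p\in\gamma_-}I([q,p],\lambda_0)<0$; for a segment $[q,p_0]\subset\gamma_+\cup\{p_0\}$,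 $I_+([q,p_0])=\lim_{p\to p_0,\,p\in\gamma_+}I([q,p],\lambda_0)>0$. **Sections and slow relation function $S_0$.** Let $\sigma_-$ (entry) and $\sigma_+$ (exit) be smooth sections transverse to $\mathcal F_{\lambda_0}$, parameterized by regular parameters $s^\pm\in[0,s_0^\pm]$, with $s^\pm=0$ corresponding to $p_0$; $\sigma_-\setminus\{p_0\}$ lies in the basin of attraction of $\gamma_-$ and $\sigma_+\setminus\{p_0\}$ lies, in backward time, in the basin of attraction of $\gamma_+$ (for $X_{\lambda_0,0}$). Let $\omega(s^-)\in\gamma_-$ be the $\omega$-limit point of the orbit of $X_{\lambda_0,0}$ through $s^-\in\sigma_-$ and $\alpha(s^+)\in\gamma_+$ the $\alpha$-limit point of the orbit through $s^+\in\sigma_+$; put $\tilde I_-(s^-)=I_-([\omega(s^-),p_0])<0$ and $\tilde I_+(s^+)=I_+([\alpha(s^+),p_0])>0$ for $s^\pm\in\,]0,s_0^\pm]$. These are smooth, with $\tilde I_-'<0$ and $\tilde I_+'>0$. Fix $s_c^-\in\,]0,s_0^-[$ and $s_c^+\in\,]0,s_0^+[$. (a) If $-\tilde I_-(s_c^-)\le\tilde I_+(s_c^+)$: $L$ is any segment (compact interval) contained in $]0,s_c^-[$, and $S_0:L\to T=S_0(L)\subset\,]0,s_c^+[$ is the smooth increasing function defined by $\tilde I_-(s^-)+\tilde I_+(S_0(s^-))=0$, $s^-\in L$. (b) If $-\tilde I_-(s_c^-)>\tilde I_+(s_c^+)$: let $s_b^-\in\,]0,s_c^-[$ be the unique point with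 $\tilde I_-(s_b^-)+\tilde I_+(s_c^+)=0$; $L$ is a segment contained in $]0,s_c^-[$ with $s_b^-$ in its interior, such that $S_0:L\to T=S_0(L)\subset\,]0,s_0^+]$, smooth and increasing, is again (well) defined by $\tilde I_-(s^-)+\tilde I_+(S_0(s^-))=0$, $s^-\in L$. *)

(* Defs.v *)
From HB Require Import structures.
From mathcomp Require Import all_boot all_order all_algebra.
From mathcomp Require Import all_classical all_reals all_analysis.

Set Implicit Arguments.
Unset Strict Implicit.
Unset Printing Implicit Defensive.

Import Order.TTheory GRing.Theory Num.Theory.
Import numFieldNormedType.Exports.

Local Open Scope classical_set_scope.
Local Open Scope ring_scope.

Section Calculus.
Context {R : realType}.

(* C^k on an open set of a finite-dimensional space. *)
Fixpoint Ck {V W : normedModType R} (U : set V) (k : nat) (f : V -> W) : Prop :=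
  match k with
  | 0 => forall x, U x -> {for x, continuous f}
  | k'.+1 => (forall x, U x -> differentiable f x) /\
             (forall v, Ck U k' ('D_v f))
  end.

(* On an arbitrary set [D] (e.g. a closed interval, or a set of parameters
   eps >= 0), smooth means: restriction of a C^oo map on an open superset. *)
Definition smooth_on {V W : normedModType R} (D : set V) (f : V -> W) : Prop :=
  exists U (g : V -> W),
    [/\ open U, D `<=` U, (forall k, Ck U k g) & forall x, D x -> g x = f x].

(* Derivative relative to [D]: the usual one at interior points of an interval
   and the one-sided one at the end points belonging to it. *)
Definition deriv_on {V : normedModType R} (D : set R) (f : R -> V) (x : R) : V :=
  lim ((y - x)^-1 *: (f y - f x) @[y --> within D (x^')]).

(* Order of vanishing at [t] of a function smooth near [t]; [None] is oo. *)
Definition vanishing_order (f : R -> R) (t : R) (n : option nat) : Prop :=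
  match n with
  | Some k => (forall i, (i < k)%N -> derive1n i f t = 0) /\ derive1n k f t != 0
  | None => forall i, derive1n i f t = 0
  end.

End Calculus.

Section PlaneGeometry.
Context {R : realType}.
Local Notation plane := 'rV[R]_2.

Definition grad (F : plane -> R) (p : plane) : plane :=
  \row_(i < 2) 'D_(delta_mx 0 i) F p.

Definition line (v : plane) : set plane := range (fun k : R => k *: v).

(* [area a p] is the area form a(x, y) dx /\ dy at the point p. *)
Definition area (a : plane -> R) (p u v : plane) : R :=
  a p * (u 0 0 * v 0 1 - u 0 1 * v 0 0).

Definition area_form_on (U : set plane) (a : plane -> R) : Prop :=
  smooth_on U a /\ forall p, U p -> a p != 0.

Definition curve_through (A : set plane) (p : plane) (c : R -> plane) : Prop :=
  exists e : R, [/\ 0 < e, smooth_on `]- e, e[ c, c @` `]- e, e[ `<=` A & c 0 = p].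

Definition regular_curve_through (A : set plane) (p : plane) (c : R -> plane) :=
  curve_through A p c /\ derive1 c 0 != 0.

Definition tangent_space (A : set plane) (p : plane) : set plane :=
  [set v | exists2 c, curve_through A p c & derive1 c 0 = v].

(* Intersection multiplicity at [p] of two regular curves: order of contact
   with [B] of a local equation of [A]. *)
Definition intersection_multiplicity (A B : set plane) (p : plane)
    (n : option nat) : Prop :=
  exists (U : set plane) (F : plane -> R) (c : R -> plane),
    [/\ open U /\ U p,
        smooth_on U F /\ (forall q, U q -> F q = 0 -> grad F q != 0),
        A `&` U = [set q | U q /\ F q = 0],
        regular_curve_through B p c
      & vanishing_order (F \o c) 0 n].

(* The segment with end points [q] and [p] of the simple arc [A]. *)
Definition segment (A : set plane) (q p : plane) : set plane :=
  xget set0 [set g | g `<=` A /\ exists c : R -> plane,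
    [/\ {within `[0, 1], continuous c}, {in `[0, 1]%R &, injective c},
        c 0 = q, c 1 = p & c @` `[0, 1] = g]].

Definition integral_curve (D : set R) (V : plane -> plane) (x : R -> plane) :=
  {within D, continuous x} /\
  forall t, interior D t -> is_derive t (1 : R) x (V (x t)).

Definition is_omega_limit_point (M : set plane) (V : plane -> plane)
    (p q : plane) : Prop :=
  exists x : R -> plane,
    [/\ integral_curve `[0, +oo[ V x, (forall t, 0 <= t -> M (x t)), x 0 = p
      & cluster (x t @[t --> +oo]) = [set q]].

Definition omega_limit_point M V p : plane :=
  xget p (is_omega_limit_point M V p).

Definition basin_of_attraction M V (A : set plane) : set plane :=
  [set p | exists2 q, A q & is_omega_limit_point M V p q].

End PlaneGeometry.

Section SlowFast.
Context {R : realType} {r : nat}.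
Local Notation plane := 'rV[R]_2.
Local Notation param := 'rV[R]_r.

(* [sf_fol l p] is the tangent line at [p] to the leaf through [p] of the fast
   foliation: one-dimensional foliations are encoded by their line fields. *)
Record slow_fast_data := SlowFastData {
  sf_M : set plane;
  sf_lam0 : param;
  sf_Lam : set param;
  sf_eps0 : R;
  sf_X : param -> R -> plane -> plane;
  sf_Q : param -> plane -> plane;
  sf_fol : param -> plane -> set plane
}.

Variable sf : slow_fast_data.
Local Notation M := (sf_M sf).
Local Notation lam0 := (sf_lam0 sf).
Local Notation Lam := (sf_Lam sf).
Local Notation eps0 := (sf_eps0 sf).
Local Notation X := (sf_X sf).
Local Notation Q := (sf_Q sf).
Local Notation fol := (sf_fol sf).

Definition critical_curve (l : param) : set plane :=
  let sing := [set p | M p /\ X l 0 p = 0] in sing `&` limit_point sing.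

(* X_{l,0} = F_l Z_l for p in U and l in a neighborhood N of lam0. *)
Definition local_expression (U : set plane) (N : set param)
    (F : param -> plane -> R) (Z : param -> plane -> plane) : Prop :=
  [/\ open U /\ U `<=` M,
      [/\ open N, N lam0 & N `<=` Lam],
      smooth_on (N `*` U) (fun z : param * plane => F z.1 z.2),
      smooth_on (N `*` U) (fun z : param * plane => Z z.1 z.2)
    & forall l p, N l -> U p ->
        [/\ X l 0 p = F l p *: Z l p,
            F l p = 0 -> grad (F l) p != 0
          & Z l p != 0]].

Definition smooth_foliation : Prop :=
  forall l p, Lam l -> M p ->
  exists (N : set param) (W : set plane) (V : param -> plane -> plane),
    [/\ [/\ open N, N l & N `<=` Lam],
        [/\ open W, W p & W `<=` M],
        smooth_on (N `*` W) (fun z : param * plane => V z.1 z.2)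
      & forall l' p', N l' -> W p' ->
          V l' p' != 0 /\ fol l' p' = line (V l' p')].

Record slow_fast_system : Prop := SlowFastSystem {
  sf_open_M : open M;
  sf_open_Lam : open Lam;
  sf_lam0_in : Lam lam0;
  sf_eps0_gt0 : 0 < eps0;
  sf_smooth_X : smooth_on (Lam `*` `[0, eps0[ `*` M)
    (fun z : param * R * plane => X z.1.1 z.1.2 z.2);
  sf_smooth_Q : smooth_on (Lam `*` M) (fun z : param * plane => Q z.1 z.2);
  sf_expansion : forall l p, Lam l -> M p ->
    exists C : R, \forall e \near (0 : R)^'+,
      `|X l e p - (X l 0 p + e *: Q l p)| <= C * e ^+ 2;
  sf_local_expression : forall p, critical_curve lam0 p ->
    exists U N F Z, U p /\ local_expression U N F Z;
  sf_smooth_fol : smooth_foliation;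
  sf_fol_local : forall U N F Z, local_expression U N F Z ->
    forall l p, N l -> U p -> fol l p = line (Z l p);
  sf_fol_X : forall l p, Lam l -> M p -> ~ critical_curve l p ->
    fol l p (X l 0 p)
}.

Definition leaf (l : param) (p : plane) : set plane :=
  [set q | exists c : R -> plane,
    [/\ smooth_on `[0 : R, 1] c, c @` `[0, 1] `<=` M, c 0 = p, c 1 = q
      & forall t : R, 0 <= t <= 1 -> fol l (c t) (deriv_on `[0, 1] c t)]].

(* Under the row-vector convention ['J f p] is the transpose of the matrix
   D f(p); the eigenvalues are the same. *)
Definition nonzero_eigenvalue (l : param) (p : plane) : set R :=
  [set a | a != 0 /\ eigenvalue (jacobian (X l 0) p) a].

Definition normally_hyperbolic (l : param) (p : plane) : Prop :=
  critical_curve l p /\ nonzero_eigenvalue l p !=set0.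

(* Unique when it exists, since D X_{l,0} is singular on the critical curve. *)
Definition sf_E (l : param) (p : plane) : R := xget 0 (nonzero_eigenvalue l p).

Definition attracting l p := normally_hyperbolic l p /\ sf_E l p < 0.

Definition repelling l p := normally_hyperbolic l p /\ 0 < sf_E l p.

Definition contact_point (l : param) (p : plane) : Prop :=
  critical_curve l p /\ char_poly (jacobian (X l 0) p) = 'X^2.

Definition contact_order (p0 : plane) (n : option nat) : Prop :=
  intersection_multiplicity (critical_curve lam0) (leaf lam0 p0) p0 n.

Definition singularity_order (p0 : plane) (m : option nat) : Prop :=
  exists U N F Z a c,
    [/\ U p0, local_expression U N F Z, area_form_on U a,
        regular_curve_through (critical_curve lam0 `&` U) p0 c
      & vanishing_order (fun t => area a (c t) (Q lam0 (c t)) (Z lam0 (c t)))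
          0 m].

Definition slow_field (l : param) (p : plane) : plane :=
  xget 0 [set v | tangent_space (critical_curve l) p v /\ fol l p (Q l p - v)].

Definition slow_divergence_integral (g : set plane) (l : param) : R :=
  xget 0 [set v | exists (t1 t2 : R) (x : R -> plane),
    [/\ t1 <= t2, {in `[t1, t2]%R &, injective x}, x @` `[t1, t2] = g,
        integral_curve `[t1, t2] (slow_field l) x
      & v = \int[lebesgue_measure]_(t in `[t1, t2]) sf_E l (x t)]].

(* [gm] and [gp] are the two half-branches of S_{lam0} at [p0], run through by
   [c] from [gm] to [gp]. *)
Definition critical_parametrization (gm : set plane) (p0 : plane)
    (gp : set plane) (c : R -> plane) : Prop :=
  [/\ smooth_on `]-1 : R, 1[ c,
      {in `]-1, 1[%R &, injective c},
      (forall t : R, -1 < t < 1 -> derive1 c t != 0),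
      c 0 = p0
    & c @` `]-1, 0[ = gm /\ c @` `]0, 1[ = gp].

Definition assumption1 (gm : set plane) (p0 : plane) (gp : set plane) : Prop :=
  [/\ critical_curve lam0 = gm `|` [set p0] `|` gp,
      (forall p, gm p -> attracting lam0 p),
      (forall p, gp p -> repelling lam0 p),
      contact_point lam0 p0
    & exists c, critical_parametrization gm p0 gp c].

Definition assumption2 (p0 : plane) (m : nat) : Prop :=
  singularity_order p0 (Some m) /\ odd m.

Definition assumption3 (gm : set plane) (p0 : plane) (gp : set plane) : Prop :=
  (forall p, (gm `|` gp) p -> slow_field lam0 p != 0) /\
  (forall c, critical_parametrization gm p0 gp c ->
    forall t : R, -1 < t < 1 -> t != 0 ->
      exists2 k : R, 0 < k & slow_field lam0 (c t) = k *: derive1 c t).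

(* Truncated subtraction agrees with the integer one here: m < 2(k - 1) fails
   for k <= 1 either way. *)
Definition assumption4 (p0 : plane) (m : nat) (n : option nat) : Prop :=
  contact_order p0 n /\ (if n is Some k then m < 2 * (k - 1) else true)%N.

(* I_-([q, p0]) for g = gamma_- and I_+([q, p0]) for g = gamma_+. *)
Definition limit_integral (g : set plane) (p0 q : plane) : R :=
  lim (slow_divergence_integral (segment g q p) lam0
       @[p --> within g (nbhs p0)]).

Definition transverse_section (p0 : plane) (sigma : R -> plane) (s0 : R) :=
  [/\ 0 < s0,
      smooth_on `[0, s0] sigma /\ {in `[0, s0]%R &, injective sigma},
      sigma @` `[0, s0] `<=` M,
      sigma 0 = p0
    & forall s, 0 <= s <= s0 ->
        ~ fol lam0 (sigma s) (deriv_on `[0, s0] sigma s)].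

Definition entry_section gm p0 sigma s0 : Prop :=
  transverse_section p0 sigma s0 /\
  forall s, 0 < s <= s0 -> basin_of_attraction M (X lam0 0) gm (sigma s).

(* Backward time: the alpha-limit for a field is the omega-limit for its
   opposite. *)
Definition exit_section gp p0 sigma s0 : Prop :=
  transverse_section p0 sigma s0 /\
  forall s, 0 < s <= s0 -> basin_of_attraction M (- X lam0 0) gp (sigma s).

Definition entry_integral gm p0 (sigma : R -> plane) (s : R) : R :=
  limit_integral gm p0 (omega_limit_point M (X lam0 0) (sigma s)).

Definition exit_integral gp p0 (sigma : R -> plane) (s : R) : R :=
  limit_integral gp p0 (omega_limit_point M (- X lam0 0) (sigma s)).

End SlowFast.

Arguments slow_fast_data : clear implicits.

Section SlowRelation.
Context {R : realType}.

(* [Im], [Ip] stand for the entry and exit integrals; L = [a, b]. *)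
Definition slow_relation (Im Ip : R -> R) (s0m s0p scm scp a b : R)
    (S0 : R -> R) : Prop :=
  [/\ (0 < scm < s0m) && (0 < scp < s0p),
      (0 < a) && (a < b < scm),
      smooth_on `[a, b] S0 /\ {in `[a, b]%R &, {homo S0 : s t / s < t}},
      (forall s, a <= s <= b -> Im s + Ip (S0 s) = 0)
    & (- Im scm <= Ip scp /\ S0 @` `[a, b] `<=` `]0, scp[) \/
      [/\ - Im scm > Ip scp,
          exists2 sb, Im sb + Ip scp = 0 & (0 < sb < scm) && (a < sb < b)
        & S0 @` `[a, b] `<=` `]0, s0p]]].

Definition is_density (D : R -> R) : Prop :=
  [/\ forall x, 0 <= D x,
      (@lebesgue_measure R).-integrable setT (EFin \o D)
    & exists P : probability (measurableTypeR R) R,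
        forall A, measurable A ->
          P A = (\int[lebesgue_measure]_(x in A) (D x)%:E)%E].

Definition has_density (mu : set R -> \bar R) (D : R -> R) : Prop :=
  is_density D /\
  forall A : set (measurableTypeR R), measurable A ->
    mu A = (\int[lebesgue_measure]_(x in A) (D x)%:E)%E.

Definition supported_on (D : R -> R) (T : set R) : Prop :=
  forall x, ~ T x -> D x = 0.

(* [S] is only meaningful on [L]. *)
Definition pushforward_on (mu : set R -> \bar R) (L : set R) (S : R -> R) :
  set R -> \bar R := fun A => mu (L `&` S @^-1` A).

Definition exit_density (Den Im Ip : R -> R) (s0m s0p : R) (L : set R)
    (S0 : R -> R) (y : R) : R :=
  - Den (pinv L S0 y) *
    (deriv_on `]0, s0p] Ip y / deriv_on `]0, s0m] Im (pinv L S0 y)) *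
    \1_(S0 @` L) y.

End SlowRelation.

(* Main.v *)
Require Import Defs.
From HB Require Import structures.
From mathcomp Require Import all_boot all_order all_algebra.
From mathcomp Require Import all_classical all_reals all_analysis.
From mathcomp Require Import measurable_realfun.
Import Order.TTheory GRing.Theory Num.Theory.
Import numFieldNormedType.Exports.
Local Open Scope classical_set_scope.
Local Open Scope ring_scope.

(** On [S0(a), S0(b)] the inverse T of S0 is C^1: differentiating
    I_-(s) + I_+(S0 s) = 0 gives T' = - I_+' / (I_-' o T) >= 0, so the exit
    density is (Den o T) T' there. The claim is the change of variables x = T y
    for nonnegative Borel functions, which holds because Lebesgue measure and
    the image under T of the measure T' dy agree on rays, by the fundamental
    theorem of calculus. *)

(** * Measures given by a density, and integration against them *)

Section density_measure.
Local Open Scope ereal_scope.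
Context {d} {T : measurableType d} {R : realType}.
Variables (mu : {measure set T -> \bar R}) (f : T -> \bar R).
Hypotheses (mf : measurable_fun setT f) (f0 : forall x, 0 <= f x).

(* The two proofs are arguments so that the measure instance on [mdensity] can
   be inferred from the term. *)
Definition mdensity (_ : measurable_fun setT f) (_ : forall x, 0 <= f x)
  (A : set T) : \bar R := \int[mu]_(x in A) f x.

Local Notation nu := (mdensity mf f0).

Let nu0 : nu set0 = 0. Proof. exact: integral_set0. Qed.

Let nu_ge0 A : 0 <= nu A. Proof. exact: integral_ge0. Qed.

Let nu_sigma_additive : semi_sigma_additive nu.
Proof. exact: semi_sigma_additive_nng_induced. Qed.

HB.instance Definition _ :=
  isMeasure.Build _ _ _ nu nu0 nu_ge0 nu_sigma_additive.

Lemma mdensity_dominated : nu `<< mu.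
Proof.
apply/null_content_dominatesP => A mA A0; apply: null_set_integral => //.
exact: measurable_funTS.
Qed.

End density_measure.
Arguments mdensity {d T R} mu {f}.

Section ge0_integral_mdensity.
Local Open Scope ereal_scope.
Context {d} {T : measurableType d} {R : realType}.
Variable mu : {sigma_finite_measure set T -> \bar R}.

(** The finite integral of [f] makes the density measure finite. It is dominated by [mu], so the
    change of variables through its Radon-Nikodym derivative applies; that derivative is [f] almost
    everywhere. *)
Lemma ge0_integral_mdensity (f g : T -> \bar R)
    (mf : measurable_fun setT f) (f0 : forall x, 0 <= f x) :
  \int[mu]_x f x < +oo ->
  measurable_fun setT g -> (forall x, 0 <= g x) ->
  \int[mdensity mu mf f0]_x g x = \int[mu]_x (g x * f x).
Proof.
move=> foo mg g0.
have nufin : fin_num_fun (mdensity mu mf f0).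
  move=> A mA; rewrite ge0_fin_numE ?measure_ge0//.
  by apply: le_lt_trans foo; exact: ge0_subset_integral.
pose nu : {finite_measure set T -> \bar R} :=
  HB.pack (mdensity mu mf f0) (Measure_isFinite.Build _ _ _ _ nufin).
have numu : nu `<< mu by exact: mdensity_dominated.
rewrite -/(integral nu _ _).
rewrite -(Radon_Nikodym_SigmaFinite.change_of_variables numu)//.
apply: ae_eq_integral => //.
- apply: emeasurable_funM => //.
  exact: measurable_int (Radon_Nikodym_SigmaFinite.f_integrable numu).
- exact: emeasurable_funM.
(* The derivative and [f] have the same integral over every measurable set, namely the density
   measure of that set, hence agree almost everywhere. *)
apply: ae_eqe_mul2l; apply: integral_ae_eq => //.
  exact: Radon_Nikodym_SigmaFinite.f_integrable.
by move=> E _ mE; rewrite -Radon_Nikodym_SigmaFinite.f_integral.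
Qed.

End ge0_integral_mdensity.

(** * Increasing substitution for nonnegative Borel functions *)

Section substitution.
Context {R : realType}.
Local Notation mu := (@lebesgue_measure R).

Lemma increasing_mem_itv {F : R -> R} {a b} :
  {in `[a, b] &, {homo F : x y / x < y}} ->
  forall x, x \in `[a, b] -> F x \in `[F a, F b].
Proof.
move=> Fincr x xab; have ab : a <= b by rewrite (itvP xab).
have Fle : {in `[a, b] &, {homo F : x y / x <= y}}.
  by move=> u v uab vab; rewrite le_eqVlt => /predU1P[->//|/Fincr/ltW]; exact.
by rewrite in_itv /= !Fle ?bound_itvE// (itvP xab).
Qed.

Lemma continuous_itv_measurable_fun {f : R -> R} {a b} :
  {within `[a, b], continuous f} -> measurable_fun `[a, b] f.
Proof. exact: subspace_continuous_measurable_fun. Qed.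

(** Both sides are measures in [A]: Lebesgue measure restricted to the image interval, and the
    push-forward under [F] of [f] dx on [[a, b]]. They agree on the rays open to the right, a
    pi-system generating the Borel sets, so they coincide. *)
Lemma itv_measure_increasing {F f : R -> R} {a b} : a < b ->
  {in `[a, b] &, {homo F : x y / x < y}} ->
  derivable_oo_LRcontinuous F a b ->
  {in `]a, b[, derive1 F =1 f} -> {within `[a, b], continuous f} ->
  {in `[a, b], forall x, 0 <= f x} ->
  forall A : set (measurableTypeR R), measurable A ->
  mu (A `&` `[F a, F b]) =
  (\int[mu]_(x in `[a, b] `&` F @^-1` A) (f x)%:E)%E.
Proof.
move=> ab Fincr dF F'f cf f0 A mA.
have cF := derivable_oo_LRcontinuous_within dF.
have mono_F : {in `[a, b] &, {mono F : x y / x < y}}.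
  exact: leW_mono_in (le_mono_in Fincr).
(* A push-forward needs a map on the whole line, so [F] is set to 0 off [[a, b]]. The default value
   attracts no mass, because the density is also 0 there. *)
have mF : measurable_fun setT (F \_ `[a, b]).
  apply/(measurable_restrictT _ (measurable_itv _)).
  exact: continuous_itv_measurable_fun.
have mt : measurable_fun setT ((EFin \o f) \_ `[a, b]).
  apply/(measurable_restrictT _ (measurable_itv _)); apply/measurable_EFinP.
  exact: continuous_itv_measurable_fun.
have t0 x : (0 <= ((EFin \o f) \_ `[a, b]) x)%E.
  by rewrite patchE; case: ifPn => // /set_mem xab; rewrite lee_fin f0.
pose m1 : {measure set (measurableTypeR R) -> \bar R} :=
  mrestr mu (measurable_itv `[F a, F b]).
(* Explicit because inference cannot find the measurability proof. *)
pose m2 : {measure set (measurableTypeR R) -> \bar R} :=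
  measure_function_pushforward__canonical__measure_function_Measure
    (mdensity mu mt t0) (mF : @measurable_fun _ _ (measurableTypeR R)
       (measurableTypeR R) _ _).
have m2E B : m2 B = (\int[mu]_(x in `[a, b] `&` F @^-1` B) (f x)%:E)%E.
  rewrite /m2 /= /pushforward /mdensity -integral_mkcondr.
  congr (integral _ _ _); apply/seteqP; split=> x /= [].
    by move=> /[swap] xab; rewrite patchE mem_set.
  by move=> xab FB; split=> //; rewrite patchE mem_set.
rewrite -m2E -/(m1 A).
have FTC y : y \in `]a, b] ->
    (\int[mu]_(x in `[a, y]) (f x)%:E = (F y - F a)%:E)%E.
  move=> yab; have ay : a < y by rewrite (itvP yab).
  have yb : y <= b by rewrite (itvP yab).
  have sub : `[a, y] `<=` `[a, b] by apply: subset_itvl; rewrite bnd_simp.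
  apply: continuous_FTC2 => //.
  - exact: continuous_subspaceW cf.
  - exact: derivable_oo_continuousW dF.
  - move=> x xay; apply: F'f.
    by move: xay; apply: subset_itvl; rewrite bnd_simp.
(* Rays exhausting the line, each of finite [m1]-mass, as uniqueness of measures requires. *)
pose g (n : nat) : set (measurableTypeR R) := `]-oo, n%:R[%classic.
refine (@measure_unique _ R (measurableTypeR R) (@RGenInftyO.G R) g
  _ _ _ _ m1 m2 _ _ A mA).
- exact: RGenInftyO.measurableE.
- move=> _ _ [x ->] [y ->]; exists (Num.min x y).
  by apply/seteqP; split=> z /=; rewrite !in_itv/= lt_min => /andP.
- by move=> n; exists n%:R.
- apply/seteqP; split=> // x _; exists (Num.bound `|x|) => //=.
  by rewrite /g/= in_itv/= (le_lt_trans (ler_norm x))// archi_boundP.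
- move=> _ [x ->]; rewrite m2E /m1/= /mrestr.
  (* Three positions of [x]: up to [F a] both masses are 0, above [F b] both are total, and in
     between [x] is a value [F y] and the preimage of the ray is [[a, y[] by strict monotonicity. *)
  have [xFa|Fax] := leP x (F a).
    rewrite (_ : `]-oo, x[ `&` `[F a, F b] = set0) ?measure0; last first.
      apply/seteqP; split=> // z /=; rewrite !in_itv/= => -[zx /andP[Faz _]].
      by move: (lt_le_trans zx xFa); rewrite ltNge Faz.
    rewrite (_ : _ `&` _ = set0) ?integral_set0//.
    apply/seteqP; split=> // z /= [zab]; rewrite in_itv/= => Fzx.
    have := increasing_mem_itv Fincr _ zab; rewrite in_itv/= => /andP[Faz _].
    by move: (lt_le_trans Fzx xFa); rewrite ltNge Faz.
  have [xFb|Fbx] := leP x (F b).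
    have [y yab Fyx] : exists2 y, y \in `[a, b] & F y = x.
      apply: (IVT (ltW ab) cF); rewrite ge_min le_max xFb orbT.
      by rewrite (ltW Fax).
    have ay : a < y by rewrite -mono_F ?bound_itvE ?ltW// Fyx.
    have yb : y <= b by rewrite (itvP yab).
    rewrite (_ : `]-oo, x[ `&` `[F a, F b] = `[F a, x[%classic); last first.
      apply/seteqP; split=> z /=; rewrite !in_itv/=.
        by move=> -[-> /andP[-> _]].
      by move=> /andP[-> zx]; rewrite zx (le_trans (ltW zx)).
    rewrite (_ : `[a, b] `&` _ = `[a, y[%classic); last first.
      apply/seteqP; split=> z /=; rewrite [in X in _ /\ X]in_itv/=.
        by move=> [zab]; rewrite -Fyx mono_F// in_itv/= (itvP zab) => ->.
      move=> zay; have zab : z \in `[a, b].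
        by rewrite in_itv/= (itvP zay)/= (le_trans (ltW _) yb)// (itvP zay).
      by split=> //; rewrite -Fyx mono_F// (itvP zay).
    rewrite lebesgue_measure_itv/= lte_fin Fax -EFinB.
    (* Adding the end point [y], a null set, gives the closed interval on which the fundamental
       theorem is stated. *)
    rewrite integral_itv_bndo_bndc; last first.
      apply/measurable_EFinP.
      apply: measurable_funS (continuous_itv_measurable_fun cf) => //.
      by apply: subset_itvl; rewrite bnd_simp.
    by rewrite FTC ?Fyx// in_itv/= ay.
  have Fab : F a < F b by rewrite mono_F ?bound_itvE ?ltW.
  rewrite (_ : `]-oo, x[ `&` `[F a, F b] = `[F a, F b]%classic); last first.
    apply/seteqP; split=> z /=; rewrite !in_itv/=; first by case.
    by move=> /andP[-> zFb]; rewrite zFb (le_lt_trans zFb).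
  rewrite (_ : `[a, b] `&` _ = `[a, b]%classic); last first.
    apply/seteqP; split=> z /=; [by case|move=> zab; split=> //].
    have := increasing_mem_itv Fincr _ zab; rewrite !in_itv/= => /andP[_ Fzb].
    exact: le_lt_trans Fbx.
  by rewrite lebesgue_measure_itv/= lte_fin Fab -EFinB FTC// in_itv/= ab lexx.
- move=> n; rewrite /m1/= /mrestr.
  apply: le_lt_trans (_ : mu `[F a, F b] < _)%E.
    apply: le_measure; rewrite ?inE; last exact: subIsetr.
      by apply: measurableI; exact: measurable_itv.
    exact: measurable_itv.
  by rewrite lebesgue_measure_itv; case: ifP => //= _; rewrite -EFinB ltry.
Qed.

(** Lebesgue measure on the image interval is a push-forward of a density measure, so the integral
    is transported first along [F] and then through the density. Only measurability of [g] is
    assumed, since an entry density need not be continuous. *)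
Lemma ge0_integration_by_substitution_increasing {F f : R -> R} {a b}
    (g : R -> \bar R) : a < b ->
  {in `[a, b] &, {homo F : x y / x < y}} ->
  derivable_oo_LRcontinuous F a b ->
  {in `]a, b[, derive1 F =1 f} -> {within `[a, b], continuous f} ->
  {in `[a, b], forall x, 0 <= f x} ->
  measurable_fun setT g -> (forall x, 0 <= g x)%E ->
  (\int[mu]_(y in `[F a, F b]) g y =
   \int[mu]_(x in `[a, b]) (g (F x) * (f x)%:E))%E.
Proof.
move=> ab Fincr dF F'f cf f0 mg g0.
have cF := derivable_oo_LRcontinuous_within dF.
have mF : measurable_fun setT (F \_ `[a, b]).
  apply/(measurable_restrictT _ (measurable_itv _)).
  exact: continuous_itv_measurable_fun.
have mt : measurable_fun setT ((EFin \o f) \_ `[a, b]).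
  apply/(measurable_restrictT _ (measurable_itv _)); apply/measurable_EFinP.
  exact: continuous_itv_measurable_fun.
have t0 x : (0 <= ((EFin \o f) \_ `[a, b]) x)%E.
  by rewrite patchE; case: ifPn => // /set_mem xab; rewrite lee_fin f0.
pose m2 : {measure set (measurableTypeR R) -> \bar R} :=
  measure_function_pushforward__canonical__measure_function_Measure
    (mdensity mu mt t0) (mF : @measurable_fun _ _ (measurableTypeR R)
       (measurableTypeR R) _ _).
transitivity (\int[m2]_(y in `[F a, F b]) g y)%E.
  apply: eq_measure_integral => A mA AF.
  rewrite /= -[in LHS](setIidl AF).
  rewrite (itv_measure_increasing ab Fincr dF F'f cf f0)//.
  rewrite /m2/= /pushforward /mdensity -integral_mkcondr.
  congr (integral _ _ _); apply/seteqP; split=> x /= [].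
    by move=> xab FA; split=> //; rewrite patchE mem_set.
  by move=> /[swap] xab; rewrite patchE mem_set.
have mD : measurable ((F \_ `[a, b]) @^-1` `[F a, F b]).
  rewrite -[X in measurable X]setTI.
  exact: (mF measurableT _ (measurable_itv _)).
rewrite /m2/= ge0_integral_pushforward//; last exact: measurable_funTS.
rewrite integral_mkcond ge0_integral_mdensity//; first last.
- by move=> x; rewrite patchE; case: ifPn => //= _.
- apply/(measurable_restrictT _ mD); apply: measurable_funTS.
  exact: measurableT_comp.
- rewrite -integral_mkcond (continuous_FTC2 ab cf dF F'f) -EFinB ltry//.
(* Off [[a, b]] the factor [f] is cut to 0, which also covers the case where the default value 0 of
   the extended [F] lies in the image interval. *)
rewrite [RHS]integral_mkcond; apply: eq_integral => x _.
rewrite [in RHS]patchE; case: ifPn => [/set_mem xab|xab]; last first.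
  by rewrite [X in (_ * X)%E]patchE (negbTE xab) mule0.
have Fx : (F \_ `[a, b]) x = F x by rewrite patchE mem_set.
have xD : x \in (F \_ `[a, b]) @^-1` `[F a, F b].
  by rewrite inE/= Fx; exact: increasing_mem_itv.
by rewrite patchE xD /= Fx patchE mem_set.
Qed.

End substitution.

(** * One-sided derivatives and the inverse of the slow relation function *)

Section calculus.
Context {R : realType}.

(** The smooth extension lives on an open superset of [D], so end points of [D] can be treated with
    ordinary two-sided derivatives. *)
Lemma smooth_on_C1 {D : set R} {f : R -> R} : smooth_on D f ->
  exists g : R -> R, [/\ forall x, D x -> \forall z \near x, derivable g z 1,
    forall x, D x -> {for x, continuous (derive1 g)} &
    forall x, D x -> g x = f x].
Proof.
move=> [U [g [oU DU gC gf]]]; have [gdiff gcont] := gC 1%N.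
exists g; split=> [x Dx|x Dx|//].
  have : nbhs x U by apply: open_nbhs_nbhs; split=> //; exact: DU.
  by apply: filterS => z /gdiff /diff_derivable; exact.
have -> : derive1 g = 'D_1 g by apply/funext => z; rewrite derive1E.
exact/gcont/DU.
Qed.

Lemma deriv_onE {D : set R} {f g : R -> R} {x : R} :
  ProperFilter (within D x^') -> D x -> (forall y, D y -> g y = f y) ->
  derivable g x 1 -> deriv_on D f x = derive1 g x.
Proof.
move=> PF Dx gf dg; rewrite derive1E.
have /is_derive1_caratheodory [h [gE hx <-]] := derivableP dg.
apply: cvg_lim => //.
have : h @ within D x^' --> h x.
  by apply: cvg_within_filter; exact/continuous_withinNx.
apply: cvg_trans; apply: near_eq_cvg; rewrite near_withinE.
near=> y => Dy; rewrite -!gf// gE /= [RHS]mulrC mulfK// subr_eq0.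
by near: y; exact: nbhs_dnbhs_neq.
Unshelve. all: by end_near. Qed.

Lemma within_itvoc_proper (s x : R) :
  0 < x <= s -> ProperFilter (within `]0, s] x^').
Proof.
move=> /andP[x0 xs]; apply: Build_ProperFilter_ex => A.
(* Approaching from the left stays inside the interval even when [x] is its right end. *)
move=> DA; have {}DA : \forall y \near x^'-, y \in `]0, s] -> A y.
  have {}DA : \forall y \near x, y != x -> y \in `]0, s] -> A y := DA.
  by rewrite near_withinE; apply: filterS DA => y + yx; apply; rewrite lt_eqF.
near (x^'-) => y.
exists y; suff: y \in `]0, s] -> A y.
  apply; rewrite in_itv/=; apply/andP; split.
    by near: y; exact: nbhs_left_gt.
  by rewrite (le_trans _ xs)//; near: y; exact: nbhs_left_le.
by near: y; exact: DA.
Unshelve. all: by end_near. Qed.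

(** Supplies what the substitution rule asks of [F := T] and [f := w]. Here [w] is the factor of the
    exit density; its derivatives are relative ones because [S0 b] may equal [s0p]. *)
Lemma slow_relation_inverse {Im Ip S0 : R -> R} {s0m s0p a b : R}
    (T := pinv `[a, b] S0)
    (w := fun y => - (deriv_on `]0, s0p] Ip y / deriv_on `]0, s0m] Im (T y))) :
  0 < a -> a < b -> b <= s0m ->
  smooth_on `]0, s0m] Im ->
  (forall s, 0 < s <= s0m -> deriv_on `]0, s0m] Im s < 0) ->
  smooth_on `]0, s0p] Ip ->
  (forall s, 0 < s <= s0p -> 0 < deriv_on `]0, s0p] Ip s) ->
  smooth_on `[a, b] S0 -> {in `[a, b] &, {homo S0 : s t / s < t}} ->
  (forall s, a <= s <= b -> Im s + Ip (S0 s) = 0) ->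
  S0 @` `[a, b] `<=` `]0, s0p] ->
  [/\ {within `[a, b], continuous S0}, {in `[a, b], cancel S0 T},
      {in `[S0 a, S0 b], cancel T S0}
    & {in `[S0 a, S0 b] &, {homo T : y z / y < z}}] /\
  [/\ derivable_oo_LRcontinuous T (S0 a) (S0 b),
      {in `]S0 a, S0 b[, derive1 T =1 w},
      {within `[S0 a, S0 b], continuous w}
    & {in `[S0 a, S0 b], forall y, 0 <= w y}].
Proof.
move=> a0 ab bs sIm Im'0 sIp Ip'0 sS Sincr ImIp SI.
have [gm [dgm cgm gmE]] := smooth_on_C1 sIm.
have [gp [dgp cgp gpE]] := smooth_on_C1 sIp.
have [gS [dgS _ gSE]] := smooth_on_C1 sS.
have Lm x : x \in `[a, b] -> 0 < x <= s0m.
  move=> xab; rewrite (lt_le_trans a0) ?(itvP xab)//=.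
  by rewrite (le_trans _ bs) ?(itvP xab).
have Sp x : x \in `[a, b] -> 0 < S0 x <= s0p.
  move=> xab; have : (S0 @` `[a, b]) (S0 x) by exists x.
  by move/SI; rewrite /= in_itv.
have Im'E x : x \in `[a, b] -> deriv_on `]0, s0m] Im x = derive1 gm x.
  move=> /Lm xm; have xm' : `]0, s0m]%classic x by rewrite /= in_itv.
  apply: deriv_onE => //; first exact: within_itvoc_proper.
  exact: nbhs_singleton (dgm _ xm').
have Ip'E y : 0 < y <= s0p -> deriv_on `]0, s0p] Ip y = derive1 gp y.
  move=> yp; have yp' : `]0, s0p]%classic y by rewrite /= in_itv.
  apply: deriv_onE => //; first exact: within_itvoc_proper.
  exact: nbhs_singleton (dgp _ yp').
have cS : {within `[a, b], continuous S0}.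
  apply: (@subspace_eq_continuous _ _ _ gS).
    by move=> x /set_mem xab; exact: gSE.
  apply: continuous_in_subspaceT => x /set_mem xab.
  apply/differentiable_continuous/derivable1_diffP.
  exact: nbhs_singleton (dgS _ xab).
have mS : {in `[a, b] &, {mono S0 : x y / x < y}}.
  exact: leW_mono_in (le_mono_in Sincr).
have Sab : S0 a < S0 b by rewrite Sincr ?bound_itvE ?ltW.
have STK : {in `[a, b], cancel S0 T}.
  move=> x xab; apply: pinvKV; last by rewrite inE.
  move=> u v /set_mem uab /set_mem vab.
  exact: (inc_inj_in (le_mono_in Sincr)).
(* By continuity [S0] reaches every value between [S0 a] and [S0 b], so its left inverse is also a
   right inverse. *)
have TSK : {in `[S0 a, S0 b], cancel T S0}.
  exact: segment_continuous_le_can_sym (ltW ab) cS STK.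
have Tin y : y \in `[S0 a, S0 b] -> T y \in `[a, b].
  move=> /(segment_continuous_le_surjective (ltW ab) (ltW Sab) cS) [x xab <-].
  by rewrite STK.
have cT : {within `[S0 a, S0 b], continuous T}.
  exact: segment_can_le_continuous (ltW ab) cS STK.
have Tincr : {in `[S0 a, S0 b] &, {homo T : y z / y < z}}.
  by move=> y z yS zS yz; rewrite -mS ?TSK ?Tin.
have wE y : y \in `[S0 a, S0 b] -> w y = - (derive1 gp y / derive1 gm (T y)).
  move=> yS; have yp := Sp _ (Tin _ yS); rewrite TSK in yp; last exact: yS.
  by rewrite /w (Im'E _ (Tin _ yS)) (Ip'E _ yp).
have dT y : y \in `]S0 a, S0 b[ -> is_derive y (1 : R) T (w y).
  move=> yoo; have yS : y \in `[S0 a, S0 b] by apply: subset_itv_oo_cc.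
  pose x := T y; have Sx : S0 x = y by exact: TSK.
  have xoo : x \in `]a, b[.
    have xab := Tin _ yS.
    have [aab bab] : a \in `[a, b] /\ b \in `[a, b] by rewrite !bound_itvE ltW.
    by rewrite in_itv/= -(mS a x)// -(mS x b)// Sx !(itvP yoo).
  have xab : x \in `[a, b] by apply: subset_itv_oo_cc.
  have nx := near_in_itvoo xoo.
  have gSx : gS x = y by rewrite gSE.
  have y0 : 0 < y <= s0p by rewrite -Sx Sp.
  have dS := derivableP (nbhs_singleton (dgS _ xab)).
  have dm : is_derive x (1 : R) gm ('D_1 gm x).
    by apply/derivableP/(nbhs_singleton (dgm _ _)); rewrite /= in_itv/= Lm.
  have dp : is_derive (gS x) (1 : R) gp ('D_1 gp (gS x)).
    by apply/derivableP/(nbhs_singleton (dgp _ _)); rewrite gSx /= in_itv.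
  have [_ dsum] := is_deriveD dm (is_derive1_comp dp dS).
  (* The extensions satisfy the defining relation only on [[a, b]]; as [x] is interior, their sum is
     0 near [x] and its derivative vanishes. *)
  have [_ dsum0] : is_derive x (1 : R) (gm + (gp \o gS)) 0.
    apply: (near_eq_is_derive _ (is_derive_cst (0 : R) x 1)).
    apply: filterS nx => z zoo.
    have zab : z \in `[a, b] by apply: subset_itv_oo_cc.
    rewrite -[RHS]/(gm z + gp (gS z)) (gSE _ zab).
    rewrite gmE; last by rewrite /= in_itv/= Lm.
    rewrite gpE; last by rewrite /= in_itv/= Sp.
    by rewrite ImIp// (itvP zab).
  have gm0 : 'D_1 gm x != 0.
    by rewrite -derive1E -Im'E// lt_eqF// Im'0// Lm.
  move: dsum; rewrite dsum0 gSx -!derive1E => /esym/eqP.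
  rewrite addrC addr_eq0 => /eqP gml.
  (* Differentiation gave I_-' = - I_+' S0'. A zero of S0' would force I_-' = 0, against its
     negative sign. *)
  have l0 : derive1 gS x != 0.
    apply: contra_neq gm0 => l0; move: gml.
    by rewrite l0 mulr0 -derive1E => /esym/eqP; rewrite oppr_eq0 => /eqP.
  rewrite -derive1E in dS.
  (* Substituting I_-' = - I_+' S0' into [w] cancels I_+', which is positive. *)
  have -> : w y = (derive1 gS x)^-1.
    rewrite wE// -/x -[derive1 gm x]opprK -gml invrN mulrN opprK invfM mulrA.
    rewrite divff ?mul1r//.
    by rewrite gt_eqF// -Ip'E// Ip'0.
  rewrite -gSx; apply: (@is_derive_inverse _ gS T) => //.
    apply: filterS nx => z zoo.
    have zab : z \in `[a, b] by apply: subset_itv_oo_cc.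
    by rewrite gSE// STK.
  apply: filterS (dgS _ xab) => z dz.
  exact/differentiable_continuous/derivable1_diffP.
split; first by split.
split=> //.
- have [_ ca cb] := (continuous_within_itvP T Sab).1 cT.
  by split=> // y /dT; case.
- by move=> y /dT [_ <-]; rewrite derive1E.
- apply: (@subspace_eq_continuous _ _ _
    (fun y => - (derive1 gp y / derive1 gm (T y)))).
    by move=> y /set_mem yS; rewrite -wE.
  (* At the end points too: the derivatives of both extensions are continuous there, and the
     denominator is negative. *)
  apply/subspace_continuousP => y yS.
  have yp : `]0, s0p]%classic y by rewrite /= in_itv/= -[y]TSK// Sp// Tin.
  have xm : `]0, s0m]%classic (T y) by rewrite /= in_itv/= Lm// Tin.
  apply: cvgN; apply: cvgM; first by apply: cvg_within_filter; exact: cgp.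
  apply: cvgV; first by rewrite -Im'E ?Tin// lt_eqF// Im'0// Lm// Tin.
  apply: (@cvg_comp _ _ _ T (derive1 gm) _ (nbhs (T y))); last exact: cgm.
  by move: y yS {yp xm}; exact/subspace_continuousP.
- move=> y yS; rewrite /w oppr_ge0 mulr_ge0_le0 ?invr_le0 ?ltW//.
    by apply: Ip'0; rewrite -[y]TSK// Sp// Tin.
  by apply: Im'0; exact/Lm/Tin.
Qed.

End calculus.

(** * The exit density and the push-forward *)

Lemma is_density_integral1 {R : realType} {D : R -> R} :
  (forall x, 0 <= D x) -> measurable_fun setT D ->
  (\int[lebesgue_measure]_x (D x)%:E = 1)%E -> is_density D.
Proof.
move=> D0 mD D1.
have mDE : measurable_fun setT (EFin \o D) by exact/measurable_EFinP.
have D0E x : (0 <= (EFin \o D) x)%E by rewrite lee_fin.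
split=> //.
  apply/integrableP; split=> //.
  by under eq_integral do rewrite gee0_abs//; rewrite D1 ltry.
(* The required probability is the measure [D] dx itself, whose total mass is the integral of
   [D]. *)
have nu1 : mdensity (@lebesgue_measure R) mDE D0E setT = 1%E by [].
pose P : probability (measurableTypeR R) R :=
  HB.pack (mdensity (@lebesgue_measure R) mDE D0E)
    (Measure_isProbability.Build _ _ _ _ nu1).
by exists P.
Qed.

Theorem proposition1 (R : realType) (r : nat) (sf : slow_fast_data R r)
    (gm gp : set 'rV[R]_2) (p0 : 'rV[R]_2) (m : nat) (n : option nat)
    (sigm sigp : R -> 'rV[R]_2) (s0m s0p scm scp a b : R)
    (S0 Den : R -> R) (mu0 : probability (measurableTypeR R) R)
    (It_m := entry_integral sf gm p0 sigm)
    (It_p := exit_integral sf gp p0 sigp)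
    (L := [set` `[a, b]])
    (Dex := exit_density Den It_m It_p s0m s0p L S0) :
  slow_fast_system sf ->
  assumption1 sf gm p0 gp ->
  assumption2 sf p0 m ->
  assumption3 sf gm p0 gp ->
  assumption4 sf p0 m n ->
  entry_section sf gm p0 sigm s0m ->
  exit_section sf gp p0 sigp s0p ->
  (smooth_on `]0, s0m] It_m /\
   forall s, 0 < s <= s0m -> deriv_on `]0, s0m] It_m s < 0) ->
  (smooth_on `]0, s0p] It_p /\
   forall s, 0 < s <= s0p -> 0 < deriv_on `]0, s0p] It_p s) ->
  slow_relation It_m It_p s0m s0p scm scp a b S0 ->
  is_density Den ->
  supported_on Den L ->
  has_density mu0 Den ->
  [/\ is_density Dex,
      supported_on Dex (S0 @` L)
    & has_density (pushforward_on mu0 L S0) Dex].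
Proof.
move=> _ _ _ _ _ _ _ [sIm Im'0] [sIp Ip'0].
move=> [/andP[/andP[scm0 scm_lt] /andP[scp0 scp_lt]] /andP[a0 /andP[ab bscm]]].
move=> [sS Sincr] ImIp SI [Den0 iDen _] suppDen [_ mu0E].
(* From here cases (a) and (b) are treated alike: in (a) the image lies below [scp], hence below
   [s0p]. *)
have {}SI : S0 @` `[a, b] `<=` `]0, s0p].
  case: SI => [[_ SI]|[_ _ //]]; apply: subset_trans SI _.
  by apply: subset_itvl; rewrite bnd_simp ltW.
have bs : b <= s0m by rewrite ltW// (lt_trans bscm).
have [[cS STK TK Tincr] [dT T'w cw w0]] :=
  slow_relation_inverse a0 ab bs sIm Im'0 sIp Ip'0 sS Sincr ImIp SI.
pose T : R -> R := pinv `[a, b] S0; rewrite -/T in STK TK Tincr dT T'w cw w0.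
pose w y := - (deriv_on `]0, s0p] It_p y / deriv_on `]0, s0m] It_m (T y)) : R.
rewrite -/w in T'w cw w0.
have Sab : S0 a < S0 b by rewrite Sincr ?bound_itvE ?ltW.
have SL : S0 @` L = `[S0 a, S0 b]%classic.
  apply/seteqP; split=> [_ [x xab <-]|y yS].
    exact: increasing_mem_itv Sincr _ xab.
  exact: segment_continuous_le_surjective (ltW ab) (ltW Sab) cS y yS.
have Ta : T (S0 a) = a by rewrite STK// bound_itvE ltW.
have Tb : T (S0 b) = b by rewrite STK// bound_itvE ltW.
(* The minus sign moves onto the quotient, making it the nonnegative [w], and the indicator becomes
   a restriction. *)
have DexE : Dex = (fun y => Den (T y) * w y) \_ `[S0 a, S0 b].
  apply/funext => y; rewrite /Dex /exit_density SL indicE patchE -/T.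
  by case: ifPn => _; rewrite ?mulr0// mulr1 mulNr -mulrN.
have mDen : measurable_fun setT Den.
  by have /measurable_EFinP := measurable_int _ iDen.
have mS : measurable_fun `[a, b] S0 by exact: continuous_itv_measurable_fun.
have mDex : measurable_fun setT Dex.
  rewrite DexE; apply/(measurable_restrictT _ (measurable_itv _)).
  apply: measurable_funM; last exact: continuous_itv_measurable_fun.
  apply: measurableT_comp => //; apply: continuous_itv_measurable_fun.
  exact: derivable_oo_LRcontinuous_within dT.
have Dex0 y : 0 <= Dex y.
  by rewrite DexE patchE; case: ifPn => // /set_mem yS; rewrite mulr_ge0// w0.
have push A : measurable A -> pushforward_on mu0 L S0 A =
    (\int[lebesgue_measure]_(y in A) (Dex y)%:E)%E.
  move=> mA; rewrite /pushforward_on; set B := L `&` _.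
  have mB : measurable B by exact: mS.
  rewrite mu0E//.
  (* Writing [L] with end points that are values of [T] fits the substitution x = T y; the integrand
     is [Den] cut to [B], the preimage of [A] in [L]. *)
  transitivity (\int[lebesgue_measure]_(x in `[T (S0 a), T (S0 b)])
      ((EFin \o Den) \_ B) x)%E.
    rewrite Ta Tb -integral_mkcondr setIidr//.
    by move=> x [].
  rewrite (ge0_integration_by_substitution_increasing _ Sab Tincr dT T'w cw w0).
  - transitivity (\int[lebesgue_measure]_(y in `[S0 a, S0 b] `&` A)
        (Den (T y) * w y)%:E)%E.
      rewrite integral_mkcondr; apply: eq_integral => y /set_mem yS.
      rewrite !patchE.
      (* Since [T] inverts [S0] and takes values in [L], cutting to [B] in x is cutting to [A] in
         y. *)
      have -> : (T y \in B) = (y \in A).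
        apply/idP/idP => /set_mem.
          by rewrite /B => -[_]; rewrite /= TK// => Ay; rewrite inE.
        move=> Ay; rewrite inE; split; last by rewrite /= TK.
        have : (S0 @` L) y by rewrite SL.
        by move=> [x xab <-]; rewrite STK.
      by case: ifPn => _; rewrite ?mul0e.
    rewrite integral_mkcondl; apply: eq_integral => y _.
    by rewrite DexE !patchE; case: ifPn.
  - apply/(measurable_restrictT _ mB); apply: measurable_funTS.
    exact/measurable_EFinP.
  - by move=> x; rewrite patchE; case: ifPn => //= _; rewrite lee_fin.
(* The push-forward formula on the whole line gives [mu0 L], which is 1 because [Den] vanishes off
   [L]. *)
have Dex1 : (\int[lebesgue_measure]_y (Dex y)%:E = 1)%E.
  rewrite -push// /pushforward_on preimage_setT setIT.
  rewrite mu0E; last exact: measurable_itv.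
  rewrite -(@probability_setT _ _ _ mu0) mu0E// integral_mkcond.
  apply: eq_integral => x _; rewrite patchE; case: ifPn => // xL.
  by rewrite suppDen//; move: xL; rewrite notin_setE.
have dDex : is_density Dex by exact: is_density_integral1.
split=> //.
by move=> y ySL; rewrite DexE -SL patchE memNset.
Qed.
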